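(* Let $q$ be a non-zero complex number such that $q^{6k}\neq 1$ for all non-zero integers $k$. Then every element of $\ker\rho$ can be written in one of the following two forms: (a) $A_1T^{s_1}A_2T^{s_2}\cdots A_{r-1}T^{s_{r-1}}A_rT^{s_r}$, (b) $T^{s_1}A_1T^{s_2}A_2\cdots T^{s_{r-1}}A_{r-1}T^{s_r}A_r$, where $r\geq 1$ is an integer, $s_i\in\mathbb{Z}$ for all $1\le i\le r$, $\sum_{i=1}^r s_i=0$, $\sum_{i=1}^r \mathrm{length}(A_i)$ is even, and $A_i\in\{\alpha_1,\alpha_2,\alpha_1\alpha_2,\alpha_2\alpha_1,\alpha_1\alpha_2\alpha_1\}$ for all $1\le i\le r$.
   Context: $C_3$ is the group of conjugating automorphisms of the free group $\mathbb{F}_3=\langle x_1,x_2,x_3\rangle$, i.e. the subgroup of $\mathrm{Aut}(\mathbb{F}_3)$ of those $\phi$ with $\phi(x_i)=f_i^{-1}x_{\Pi(i)}f_i$ for a permutation $\Pi$ of $\{1,2,3\}$ and some $f_i\in\mathbb{F}_3$. It is presented by generators $\sigma_1,\sigma_2,\alpha_1,\alpha_2$ and relations $\sigma_1\sigma_2\sigma_1=\sigma_2\sigma_1\sigma_2$, $\alpha_1^2=\alpha_2^2=1$, $\alpha_1\alpha_2\alpha_1=\alpha_2\alpha_1\alpha_2$, $\sigma_1\alpha_2\alpha_1=\alpha_2\alpha_1\sigma_2$, $\sigma_2\sigma_1\alpha_2=\alpha_1\sigma_2\sigma_1$. For a fixed non-zero complex number $q$, the representation $\rho:C_3\to GL_3(\mathbb{C})$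 is the homomorphism given by $$\rho(\sigma_1)=\begin{pmatrix} q^2&0&0\\ q(q-1)&1-q&q\\ 0&1&0\end{pmatrix},\quad \rho(\sigma_2)=\begin{pmatrix}1-q&q&q(q-1)\\1&0&0\\0&0&q^2\end{pmatrix},$$ $$\rho(\alpha_1)=\begin{pmatrix}1&0&0\\0&0&1\\0&1&0\end{pmatrix},\quad \rho(\alpha_2)=\begin{pmatrix}0&1&0\\1&0&0\\0&0&1\end{pmatrix}.$$ $T=\sigma_2\alpha_2\alpha_1\in C_3$. The length of a word is the sum of the absolute values of the exponents of the generators in it; thus $\alpha_1,\alpha_2$ have length $1$, $\alpha_1\alpha_2,\alpha_2\alpha_1$ have length $2$, and $\alpha_1\alpha_2\alpha_1$ has length $3$. *)

(* Defs.v *)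
From HB Require Import structures.
From mathcomp Require Import all_boot all_order all_algebra.
From mathcomp Require Import fingroup perm.
From mathcomp Require Import boolp reals.
From mathcomp Require Import complex.

Set Implicit Arguments.
Unset Strict Implicit.
Unset Printing Implicit Defensive.

Import GRing.Theory.
Local Open Scope group_scope.

Section FreeGroup.
Variable n : nat.

(* The letter (i, false) stands for x_i and (i, true) for x_i^-1. *)
Definition letter : Type := 'I_n * bool.

Definition letterV (a : letter) : letter := (a.1, ~~ a.2).

Lemma letterVK : involutive letterV.
Proof. by move=> [i b]; rewrite /letterV /= negbK. Qed.

Definition no_cancel : rel letter := [rel a b | b != letterV a].

Definition reduced (w : seq letter) : bool := sorted no_cancel w.

(* Elements of the free group of rank n are the freely reduced words. *)
Record free_group : Type :=
  FreeGroup { word_of : seq letter; word_ofP : reduced word_of }.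

HB.instance Definition _ := [isSub for word_of].
HB.instance Definition _ := [Choice of free_group by <:].

Definition push (a : letter) (w : seq letter) : seq letter :=
  if w is b :: v then if b == letterV a then v else a :: w else [:: a].

Lemma reduced_push a w : reduced w -> reduced (push a w).
Proof.
case: w => [|b w] //= rw; case: ifPn => [_|nab]; first exact: path_sorted rw.
by apply/andP; split.
Qed.

Lemma pushVK a w : reduced w -> push a (push (letterV a) w) = w.
Proof.
case: w => [|b w] /=; first by rewrite eqxx.
rewrite letterVK; case: eqP => [-> | _] /=; last by rewrite eqxx.
by case: w => [|c w] //= /andP[/negPf ->].
Qed.

Lemma push_id a w : reduced (a :: w) -> push a w = a :: w.
Proof. by case: w => [|b w] //= /andP[/negPf ->]. Qed.

Definition cat_reduce (u v : seq letter) : seq letter := foldr push v u.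

Lemma reduced_cat u v : reduced v -> reduced (cat_reduce u v).
Proof. by move=> rv; elim: u => //= a u; apply: reduced_push. Qed.

Lemma cat_reduce_push a v w : reduced w ->
  cat_reduce (push a v) w = push a (cat_reduce v w).
Proof.
move=> rw; case: v => [|b v] //=; case: eqP => [-> | _] //=.
by rewrite pushVK //; apply: reduced_cat.
Qed.

Lemma cat_reduceA u v w : reduced w ->
  cat_reduce u (cat_reduce v w) = cat_reduce (cat_reduce u v) w.
Proof. by move=> rw; elim: u => //= a u ->; rewrite cat_reduce_push. Qed.

Lemma cat_reduce0 u : reduced u -> cat_reduce u [::] = u.
Proof.
elim: u => //= a u IHu ru.
rewrite -[LHS]/(push a (cat_reduce u [::])) IHu ?push_id //.
exact: path_sorted ru.
Qed.

Definition wordV (w : seq letter) : seq letter := rev (map letterV w).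

Lemma reduced_wordV w : reduced w -> reduced (wordV w).
Proof.
rewrite /reduced /wordV rev_sorted sorted_map; apply: sub_sorted => a b.
by rewrite /no_cancel /= letterVK eq_sym.
Qed.

Lemma cat_reduceVw w : reduced w -> cat_reduce (wordV w) w = [::].
Proof.
elim: w => //= a w IHw rw.
rewrite /wordV /= rev_cons -cats1 /cat_reduce foldr_cat /= letterVK eqxx.
by apply: IHw; apply: path_sorted rw.
Qed.

Lemma wordVK : involutive wordV.
Proof.
move=> w; rewrite /wordV map_rev revK -map_comp -[RHS]map_id.
by apply: eq_map => a /=; rewrite letterVK.
Qed.

Definition free_one : free_group := FreeGroup (isT : reduced [::]).
Definition free_mul (u v : free_group) : free_group :=
  FreeGroup (reduced_cat (word_of u) (word_ofP v)).
Definition free_inv (u : free_group) : free_group :=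
  FreeGroup (reduced_wordV (word_ofP u)).

Lemma free_mulA : associative free_mul.
Proof. by move=> u v w; apply/val_inj/cat_reduceA/(word_ofP w). Qed.
Lemma free_mul1 : left_id free_one free_mul.
Proof. by move=> u; apply/val_inj. Qed.
Lemma free_mulr1 : right_id free_one free_mul.
Proof. by move=> u; apply/val_inj/cat_reduce0/(word_ofP u). Qed.
Lemma free_mulV : left_inverse free_one free_inv free_mul.
Proof. by move=> u; apply/val_inj/cat_reduceVw/(word_ofP u). Qed.
Lemma free_mulrV : right_inverse free_one free_inv free_mul.
Proof.
move=> u; apply/val_inj; rewrite /= -{1}[word_of u]wordVK.
exact/cat_reduceVw/reduced_wordV/(word_ofP u).
Qed.

HB.instance Definition _ := isGroup.Build free_group
  free_mulA free_mul1 free_mulr1 free_mulV free_mulrV.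

Definition free_gen (i : 'I_n) : free_group := FreeGroup (isT : reduced [:: (i, false)]).

(* The homomorphism from the free group that maps x_i to c i. *)
Definition free_ext (G : groupType) (c : 'I_n -> G) (u : free_group) : G :=
  foldr (fun (a : letter) g => (if a.2 then (c a.1)^-1 else c a.1) * g) 1 (word_of u).

Lemma free_ext_gen (G : groupType) (c : 'I_n -> G) i :
  free_ext c (free_gen i) = c i.
Proof. exact: mulg1. Qed.

Lemma free_extM (G : groupType) (c : 'I_n -> G) :
  {morph free_ext c : u v / u * v}.
Proof.
move=> u v; rewrite /free_ext /=; move: (word_of v) => {}v.
set h := foldr _ 1; elim: (word_of u) => [|a {}u IHu] /=; first by rewrite mul1g.
rewrite -mulgA -IHu; case: (cat_reduce u v) => [|b w] //=.
case: eqP => [-> | _] //=; case: a => i [] /=.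
  by rewrite mulKg.
by rewrite mulVKg.
Qed.

HB.instance Definition _ (G : groupType) (c : 'I_n -> G) :=
  isMultiplicative.Build free_group G (free_ext c) (free_extM c).

Lemma free_ext1 (G : groupType) (c : 'I_n -> G) : free_ext c 1 = 1.
Proof. by []. Qed.

HB.instance Definition _ (G : groupType) (c : 'I_n -> G) :=
  Multiplicative_isUMagmaMorphism.Build free_group G (free_ext c)
    (free_ext1 c).

Lemma free_extV (G : groupType) (c : 'I_n -> G) u :
  free_ext c u^-1 = (free_ext c u)^-1.
Proof. exact: gmulfV. Qed.

Lemma free_gen_ind (P : free_group -> Prop) :
  P 1 -> (forall i u, P u -> P (free_gen i * u)) ->
  (forall i u, P u -> P ((free_gen i)^-1 * u)) -> forall u, P u.
Proof.
move=> P1 Px PV [w rw].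
elim: w rw => [|[i b] w IHw] rw; first by rewrite (_ : FreeGroup _ = 1) //; apply/val_inj.
have rw' : reduced w := path_sorted rw.
have -> : FreeGroup rw =
   (if b then (free_gen i)^-1 else free_gen i) * FreeGroup rw'.
  by apply/val_inj; case: b rw => rw /=; rewrite -[LHS]push_id.
by case: b rw => _; [apply: PV | apply: Px].
Qed.

End FreeGroup.

Section Automorphisms.
Variable G : groupType.

Definition is_aut : pred (G -> G) :=
  fun f => `[< bijective f /\ {morph f : x y / x * y} >].

Record aut : Type := Aut { aut_fun : G -> G; aut_funP : is_aut aut_fun }.

HB.instance Definition _ := [isSub for aut_fun].
HB.instance Definition _ := [Choice of aut by <:].

Lemma autP (f : aut) : bijective (aut_fun f) /\ {morph aut_fun f : x y / x * y}.
Proof. exact/asboolP/(aut_funP f). Qed.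

Lemma aut_funM (f : aut) : {morph aut_fun f : x y / x * y}.
Proof. by case: (autP f). Qed.

Lemma aut_fun1 (f : aut) : aut_fun f 1 = 1.
Proof. by apply: (mulgI (aut_fun f 1)); rewrite -aut_funM !mulg1. Qed.

Lemma aut_funV (f : aut) x : aut_fun f x^-1 = (aut_fun f x)^-1.
Proof.
by apply: (mulgI (aut_fun f x)); rewrite -aut_funM !mulgV aut_fun1.
Qed.

Lemma is_aut_id : is_aut id.
Proof. by apply/asboolP; split=> //; exists id. Qed.

Lemma is_aut_comp (f g : aut) : is_aut (aut_fun g \o aut_fun f).
Proof.
have [[bf Mf] [bg Mg]] := (autP f, autP g); apply/asboolP; split.
  exact: bij_comp.
by move=> x y /=; rewrite Mf Mg.
Qed.

Lemma aut_inv_exists (f : aut) :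
  {g : G -> G | cancel (aut_fun f) g /\ cancel g (aut_fun f)}.
Proof. by apply: cid; have [[g fK gK] _] := autP f; exists g. Qed.

Lemma is_aut_inv (f : aut) : is_aut (sval (aut_inv_exists f)).
Proof.
case: (aut_inv_exists f) => g [fK gK] /=; apply/asboolP; split.
  by exists (aut_fun f).
by move=> x y; rewrite -{1}[x]gK -{1}[y]gK -(autP f).2 fK.
Qed.

Definition aut_one : aut := Aut is_aut_id.
(* Automorphisms act on the right: f * g means "first f, then g". *)
Definition aut_mul (f g : aut) : aut := Aut (is_aut_comp f g).
Definition aut_inv (f : aut) : aut := Aut (is_aut_inv f).

Lemma aut_mulA : associative aut_mul.
Proof. by move=> f g h; apply/val_inj. Qed.
Lemma aut_mul1 : left_id aut_one aut_mul.
Proof. by move=> f; apply/val_inj. Qed.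
Lemma aut_mulr1 : right_id aut_one aut_mul.
Proof. by move=> f; apply/val_inj. Qed.
Lemma aut_mulV : left_inverse aut_one aut_inv aut_mul.
Proof.
move=> f; apply/val_inj/funext => x /=.
by case: (aut_inv_exists f) => g [].
Qed.
Lemma aut_mulrV : right_inverse aut_one aut_inv aut_mul.
Proof.
move=> f; apply/val_inj/funext => x /=.
by case: (aut_inv_exists f) => g [].
Qed.

HB.instance Definition _ := isGroup.Build aut
  aut_mulA aut_mul1 aut_mulr1 aut_mulV aut_mulrV.

End Automorphisms.

Section ConjugatingAutomorphisms.
Variable n : nat.
Local Notation x := (@free_gen n).

(* In the library u ^ f denotes f^-1 * (u * f). *)
Definition conjugating : pred (aut (free_group n)) :=
  fun phi => `[< exists (p : 'S_n) (f : 'I_n -> free_group n),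
                   forall i, aut_fun phi (x i) = x (p i) ^ f i >].

Lemma aut_conj (phi : aut (free_group n)) u v :
  aut_fun phi (u ^ v) = aut_fun phi u ^ aut_fun phi v.
Proof. by rewrite !conjgE !aut_funM aut_funV. Qed.

Lemma conjugating_group : group_closed conjugating.
Proof.
split; first by apply/asboolP; exists 1, (fun=> 1) => i; rewrite perm1 conjg1.
move=> phi psi /asboolP[p [f Ef]] /asboolP[r [g Eg]].
have [K1 K2] : (forall u, aut_fun psi^-1 (aut_fun psi u) = u) /\
    (forall u, aut_fun psi (aut_fun psi^-1 u) = u).
  by split=> u; [have := mulgV psi | have := mulVg psi];
     move/(congr1 (fun h => aut_fun h u)).
apply/asboolP; exists (p * r^-1), (fun i =>
  ((aut_fun psi^-1 (g (r^-1 (p i))))^-1 * aut_fun psi^-1 (f i))) => i.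
rewrite -[LHS]/(aut_fun psi^-1 (aut_fun phi (x i))) Ef aut_conj permM conjgM.
congr (_ ^ _); set j := r^-1 (p i).
have -> : p i = r j by rewrite /j permKV.
apply: (conjg_inj (aut_fun psi^-1 (g j))).
by rewrite -aut_conj -Eg K1 conjgKV.
Qed.

Record conj_aut : Type := ConjAut {
  conj_aut_val : aut (free_group n);
  conj_aut_valP : conjugating conj_aut_val }.

HB.instance Definition _ := [isSub for conj_aut_val].
HB.instance Definition _ := [Choice of conj_aut by <:].
HB.instance Definition _ := SubChoice_isSubGroup.Build
  (aut (free_group n)) conjugating conj_aut conjugating_group.

Definition conj_act (phi : conj_aut) : free_group n -> free_group n :=
  aut_fun (conj_aut_val phi).

Section Build.
Variables c d : 'I_n -> free_group n.
Hypothesis cd : forall i, free_ext c (d i) = x i.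
Hypothesis dc : forall i, free_ext d (c i) = x i.

Lemma free_extK (a b : 'I_n -> free_group n) :
  (forall i, free_ext a (b i) = x i) -> cancel (free_ext b) (free_ext a).
Proof.
move=> ab; elim/free_gen_ind => [//|i u IHu|i u IHu].
  by rewrite free_extM free_ext_gen free_extM IHu ab.
by rewrite free_extM free_extV free_ext_gen free_extM free_extV IHu ab.
Qed.

Lemma free_ext_aut : is_aut (free_ext c).
Proof.
apply/asboolP; split; last exact: free_extM.
by exists (free_ext d); apply: free_extK.
Qed.

Variables (p : 'S_n) (f : 'I_n -> free_group n).
Hypothesis cE : forall i, c i = x (p i) ^ f i.

Lemma free_ext_conjugating :
  conjugating (Aut free_ext_aut).
Proof. by apply/asboolP; exists p, f => i; rewrite -cE; apply: free_ext_gen. Qed.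

Definition conj_aut_of_images : conj_aut := ConjAut free_ext_conjugating.
End Build.

Lemma conj_aut_eq (phi psi : conj_aut) :
  (forall i, conj_act phi (x i) = conj_act psi (x i)) -> phi = psi.
Proof.
move=> E; suff Eu u : conj_act phi u = conj_act psi u.
  by do 2![apply/val_inj]; apply/funext.
rewrite /conj_act in E *; elim/free_gen_ind: u => [|i u IHu|i u IHu].
- by rewrite !aut_fun1.
- by rewrite !aut_funM IHu E.
- by rewrite !aut_funM !aut_funV IHu E.
Qed.

End ConjugatingAutomorphisms.

Notation F3 := (free_group 3).
Notation C3 := (conj_aut 3).

Definition i1 : 'I_3 := @Ordinal 3 0 isT.
Definition i2 : 'I_3 := @Ordinal 3 1 isT.
Definition i3 : 'I_3 := @Ordinal 3 2 isT.
Definition x1 : F3 := free_gen i1.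
Definition x2 : F3 := free_gen i2.
Definition x3 : F3 := free_gen i3.

Definition triple (a b c : F3) (i : 'I_3) : F3 := nth 1 [:: a; b; c] i.

Lemma ord3P (P : 'I_3 -> Prop) : P i1 -> P i2 -> P i3 -> forall i, P i.
Proof.
move=> P1 P2 P3 [[|[|[|//]]] Hi].
- by rewrite (_ : Ordinal Hi = i1) //; apply/val_inj.
- by rewrite (_ : Ordinal Hi = i2) //; apply/val_inj.
- by rewrite (_ : Ordinal Hi = i3) //; apply/val_inj.
Qed.

(* sigma_i : x_i |-> x_i x_(i+1) x_i^-1,  x_(i+1) |-> x_i. *)
Definition sigma1_img := triple (x1 * x2 * x1^-1) x1 x3.
Definition sigma1_inv := triple x2 (x2^-1 * x1 * x2) x3.
Definition sigma2_img := triple x1 (x2 * x3 * x2^-1) x2.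
Definition sigma2_inv := triple x1 x3 (x3^-1 * x2 * x3).
Definition alpha1_img := triple x2 x1 x3.
Definition alpha2_img := triple x1 x3 x2.

Lemma sigma1K : forall i, free_ext sigma1_img (sigma1_inv i) = free_gen i.
Proof. by apply: ord3P; apply/val_inj; vm_compute. Qed.
Lemma sigma1VK : forall i, free_ext sigma1_inv (sigma1_img i) = free_gen i.
Proof. by apply: ord3P; apply/val_inj; vm_compute. Qed.
Lemma sigma2K : forall i, free_ext sigma2_img (sigma2_inv i) = free_gen i.
Proof. by apply: ord3P; apply/val_inj; vm_compute. Qed.
Lemma sigma2VK : forall i, free_ext sigma2_inv (sigma2_img i) = free_gen i.
Proof. by apply: ord3P; apply/val_inj; vm_compute. Qed.
Lemma alpha1K : forall i, free_ext alpha1_img (alpha1_img i) = free_gen i.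
Proof. by apply: ord3P; apply/val_inj; vm_compute. Qed.
Lemma alpha2K : forall i, free_ext alpha2_img (alpha2_img i) = free_gen i.
Proof. by apply: ord3P; apply/val_inj; vm_compute. Qed.

Lemma sigma1_conj i :
  sigma1_img i = free_gen (tperm i1 i2 i) ^ triple x1^-1 1 1 i.
Proof.
by elim/ord3P: i; rewrite ?tpermL ?tpermR ?tpermD //; apply/val_inj; vm_compute.
Qed.
Lemma sigma2_conj i :
  sigma2_img i = free_gen (tperm i2 i3 i) ^ triple 1 x2^-1 1 i.
Proof.
by elim/ord3P: i; rewrite ?tpermL ?tpermR ?tpermD //; apply/val_inj; vm_compute.
Qed.
Lemma alpha1_conj i : alpha1_img i = free_gen (tperm i1 i2 i) ^ 1.
Proof.
by elim/ord3P: i; rewrite ?tpermL ?tpermR ?tpermD //; apply/val_inj; vm_compute.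
Qed.
Lemma alpha2_conj i : alpha2_img i = free_gen (tperm i2 i3 i) ^ 1.
Proof.
by elim/ord3P: i; rewrite ?tpermL ?tpermR ?tpermD //; apply/val_inj; vm_compute.
Qed.

Definition sigma1 : C3 := conj_aut_of_images sigma1K sigma1VK sigma1_conj.
Definition sigma2 : C3 := conj_aut_of_images sigma2K sigma2VK sigma2_conj.
Definition alpha1 : C3 := conj_aut_of_images alpha1K alpha1K alpha1_conj.
Definition alpha2 : C3 := conj_aut_of_images alpha2K alpha2K alpha2_conj.

(* The defining relations of C_3. The last one holds because automorphisms act
   on the right; it fails for these generators with the opposite product. *)
Lemma C3_relations :
  [/\ sigma1 * sigma2 * sigma1 = sigma2 * sigma1 * sigma2,
      alpha1 * alpha1 = 1 /\ alpha2 * alpha2 = 1,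
      alpha1 * alpha2 * alpha1 = alpha2 * alpha1 * alpha2,
      sigma1 * alpha2 * alpha1 = alpha2 * alpha1 * sigma2 &
      sigma2 * sigma1 * alpha2 = alpha1 * sigma2 * sigma1].
Proof.
by do !split; apply: conj_aut_eq; apply: ord3P; apply/val_inj; vm_compute.
Qed.

Inductive generator := Sigma1 | Sigma2 | Alpha1 | Alpha2.

Definition generator_code (a : generator) : nat :=
  match a with Sigma1 => 0 | Sigma2 => 1 | Alpha1 => 2 | Alpha2 => 3 end.
Definition generator_decode (k : nat) : generator :=
  nth Alpha2 [:: Sigma1; Sigma2; Alpha1] k.
Lemma generator_codeK : cancel generator_code generator_decode.
Proof. by case. Qed.
HB.instance Definition _ := Equality.copy generator (can_type generator_codeK).

Definition generator_val (a : generator) : C3 :=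
  match a with
  | Sigma1 => sigma1 | Sigma2 => sigma2 | Alpha1 => alpha1 | Alpha2 => alpha2
  end.

Definition expgz (G : groupType) (g : G) (k : int) : G :=
  match k with Posz m => g ^+ m | Negz m => g ^- m.+1 end.

(* The pair (a, k) stands for the power a^k of the generator a. *)
Definition word : Type := seq (generator * int).

Definition word_val (w : word) : C3 :=
  \prod_(a <- w) expgz (generator_val a.1) a.2.

Definition word_length (w : word) : nat := (\sum_(a <- w) `|a.2|)%N.

Definition alpha_words : seq word :=
  [:: [:: (Alpha1, 1%Z)];
      [:: (Alpha2, 1%Z)];
      [:: (Alpha1, 1%Z); (Alpha2, 1%Z)];
      [:: (Alpha2, 1%Z); (Alpha1, 1%Z)];
      [:: (Alpha1, 1%Z); (Alpha2, 1%Z); (Alpha1, 1%Z)]].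

Definition T : C3 := sigma2 * alpha2 * alpha1.

Local Open Scope ring_scope.

Definition mx_of_rows (K : nzRingType) (rows : seq (seq K)) : 'M[K]_3 :=
  \matrix_(i, j) nth 0 (nth [::] rows i) j.

Definition GL_hom (G : groupType) (K : comUnitRingType) (n : nat)
    (rho : G -> 'M[K]_n) : Prop :=
  (forall g, rho g \in unitmx) /\
  (forall g h, rho (g * h)%g = rho g *m rho h).

(* Since C_3 is generated by sigma_1, sigma_2, alpha_1, alpha_2, at most one rho
   satisfies this predicate. *)
Definition is_rho (R : realType) (q : R[i]) (rho : C3 -> 'M[R[i]]_3) : Prop :=
  [/\ GL_hom rho,
      rho sigma1 = mx_of_rows [:: [:: q ^+ 2;      0;     0];
                                  [:: q * (q - 1); 1 - q; q];
                                  [:: 0;           1;     0]],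
      rho sigma2 = mx_of_rows [:: [:: 1 - q; q; q * (q - 1)];
                                  [:: 1;     0; 0];
                                  [:: 0;     0; q ^+ 2]],
      rho alpha1 = mx_of_rows [:: [:: 1; 0; 0];
                                  [:: 0; 0; 1];
                                  [:: 0; 1; 0]] &
      rho alpha2 = mx_of_rows [:: [:: 0; 1; 0];
                                  [:: 1; 0; 0];
                                  [:: 0; 0; 1]]].

(* Main.v *)
(* Since sigma2 = T alpha1 alpha2 and sigma1 is conjugate to sigma2 by
   alpha2 alpha1, once C_3 is known to be generated by the sigmas and the alphas,
   every element is a product of factors A T^s (s = 0 being allowed).  For an
   element of the kernel, det T = - q^3 and det alpha = -1 give
   (-1)^length (- q^3)^(sum of the s) = 1; squaring, genericity of q forces the
   sum to vanish, and then the length is even.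
   Generation by permutations and the maps x_j |-> x_i x_j x_i^-1 is a descent on
   the total length of the conjugators f_i in phi (x_i) = f_i x_(p i) f_i^-1: if no
   such map shortens them, a ping-pong argument on reduced words shows that the
   first letters of phi u contain some f_i, so that surjectivity of phi makes every
   f_i trivial. *)
Require Import Defs.
From mathcomp Require Import all_boot all_order all_algebra.
From mathcomp Require Import reals complex.
From mathcomp Require Import fingroup perm boolp ring.

Import GRing.Theory.
Local Open Scope ring_scope.

(** * Prefixes and cancellation in reduced words *)

Lemma prefix_of_rcons (T : eqType) (s t : seq T) x :
  prefix s (rcons t x) = (s == rcons t x) || prefix s t.
Proof.
apply/idP/orP => [/prefixP[z]|[/eqP->|/prefixP[z ->]]].
- case/lastP: z => [|z y]; first by rewrite cats0 => ->; left.
  rewrite -rcons_cat => /eqP; rewrite eqseq_rcons => /andP[/eqP-> _].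
  by right; apply: prefix_prefix.
- exact: prefix_refl.
- by rewrite rcons_cat prefix_prefix.
Qed.

Section Words.
Local Open Scope group_scope.
Variable n : nat.
Implicit Types (a b : letter n) (u v w : seq (letter n)).

Lemma reduced_rcons_cat u b v :
  reduced (rcons u b) -> reduced (b :: v) -> reduced (u ++ b :: v).
Proof.
case: u => [|c u] //= ; rewrite /reduced /= rcons_path cat_path /=.
by case/andP=> -> -> ->.
Qed.

Lemma cat_reduce_cat u v : reduced (u ++ v) -> cat_reduce u v = u ++ v.
Proof.
elim: u => //= a u IHu ru.
by rewrite -[LHS]/(push a (cat_reduce u v)) IHu ?push_id //; apply: path_sorted ru.
Qed.

Lemma size_cat_reduce u v : (size (cat_reduce u v) <= size u + size v)%N.
Proof.
elim: u => //= a u IHu; rewrite addSn.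
move: IHu; case: (cat_reduce u v) => [|b w] //= IHu.
by case: ifP => _ /=; [apply: leq_trans (leqnSn _) (leqW IHu) | apply: IHu].
Qed.

Definition letter_gen a : free_group n := FreeGroup (isT : reduced [:: a]).

Lemma letter_genV a : ((letter_gen a)^-1) = letter_gen (letterV a).
Proof. exact/val_inj. Qed.

Lemma FreeGroup_cons a u (r : reduced (a :: u)) :
  FreeGroup r = (letter_gen a * FreeGroup (path_sorted r : reduced u)).
Proof. by apply/val_inj; rewrite /= -[LHS]push_id. Qed.

(** Put [z = f^-1 * w], so that the product is [f a z]. If [z] began with the inverse of [a], then
    [w = f z] would be a concatenation without cancellation and begin with [f a^-1], which is
    excluded. Hence nothing cancels in [f a z]. *)
Lemma prefix_conj_mul (f w : free_group n) a :
  reduced (rcons (word_of f) a) -> reduced (rcons (word_of f) (letterV a)) ->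
  ~~ prefix (rcons (word_of f) (letterV a)) (word_of w) ->
  prefix (rcons (word_of f) a) (word_of (f * letter_gen a * f^-1 * w)).
Proof.
move=> rfa rfV; set z := (f^-1 * w).
have -> : w = (f * z) by rewrite /z mulVKg.
have -> : (f * letter_gen a * f^-1 * (f * z) = f * (letter_gen a * z)).
  by rewrite !mulgA mulgKV.
move=> nfV.
have hz : push a (word_of z) = a :: word_of z.
  move: nfV; case: z => [[|c z] rz] //=; case: eqP => // cE; subst c.
  rewrite cat_reduce_cat; last exact: reduced_rcons_cat.
  by rewrite -cat_rcons prefix_prefix.
rewrite /= hz cat_reduce_cat -?cat_rcons ?prefix_prefix // cat_rcons.
by apply: reduced_rcons_cat rfa _; rewrite -hz; apply/reduced_push/word_ofP.
Qed.

End Words.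

(** * Generation of the conjugating automorphisms by permutations and partial conjugations *)

Section Generation.
Local Open Scope group_scope.
Variable n : nat.
Local Notation x := (@free_gen n).
Implicit Types (phi : conj_aut n) (p : 'S_n) (f : 'I_n -> free_group n).

Lemma conj_actM phi psi u :
  conj_act (phi * psi) u = conj_act psi (conj_act phi u).
Proof. by []. Qed.

Lemma conj_act_mul phi u v :
  conj_act phi (u * v) = (conj_act phi u * conj_act phi v).
Proof. exact: aut_funM. Qed.

Lemma conj_actV phi u : conj_act phi (u^-1) = ((conj_act phi u)^-1).
Proof. exact: aut_funV. Qed.

Lemma conj_act_letter phi p f :
  (forall i, conj_act phi (x i) = (f i * x (p i) * (f i)^-1)) ->
  forall a, conj_act phi (letter_gen _ a) =
    (f a.1 * letter_gen _ (p a.1, a.2) * (f a.1)^-1).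
Proof.
move=> phiE [i []] /=; last exact: phiE.
rewrite -[(i, true)]/(letterV (i, false)) -letter_genV conj_actV.
rewrite -[letter_gen _ _]/(x i) phiE !invgM invgK.
by rewrite -mulgA; congr (_ * (_ * _)); apply: letter_genV.
Qed.

(* Ping-pong: phi (x_i) ^ e maps the words outside the cylinder of
   f_i x_(p i) ^ (-e) into the cylinder of f_i x_(p i) ^ e, and distinct
   cylinders are disjoint. *)
Lemma conj_act_prefix phi p f :
  (forall i, conj_act phi (x i) = (f i * x (p i) * (f i)^-1)) ->
  (forall i b, reduced (rcons (word_of (f i)) (p i, b))) ->
  (forall i j b, i != j -> ~~ prefix (rcons (word_of (f i)) (p i, b)) (word_of (f j))) ->
  forall a u (r : reduced (a :: u)),
    prefix (rcons (word_of (f a.1)) (p a.1, a.2)) (word_of (conj_act phi (FreeGroup r))).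
Proof.
move=> phiE rf npf.
(* Nested cylinders coincide. Equal words have the same last letter, and [p] is injective. A proper
   prefix would be a prefix of [f j], excluded by [npf] if [i != j] and by length if [i = j]. *)
have disj a b : prefix (rcons (word_of (f a.1)) (p a.1, a.2))
    (rcons (word_of (f b.1)) (p b.1, b.2)) -> a = b.
  case: a b => [i e] [j d] /=; rewrite prefix_of_rcons => /orP[|].
    by rewrite eqseq_rcons => /andP[_ /eqP[/perm_inj -> ->]].
  case: (eqVneq i j) => [-> /size_prefix|ij]; last by rewrite (negPf (npf _ _ _ ij)).
  by rewrite size_rcons ltnn.
move=> a u; elim: u a => [|b u IHu] a r; rewrite FreeGroup_cons conj_act_mul
  (conj_act_letter _ _ _ phiE); apply: prefix_conj_mul => //; try exact: rf.
  rewrite (_ : FreeGroup _ = 1); last exact/val_inj.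
  by rewrite [conj_act _ _]aut_fun1; case: (word_of _).
(* Otherwise the cylinder words of [b] and of [letterV a] are both prefixes of the image of [w],
   hence comparable. Then [disj] gives [b = letterV a], against the reducedness of [a :: b :: u]. *)
set w := FreeGroup _; apply/negP => pw.
have pb : prefix (rcons (word_of (f b.1)) (p b.1, b.2)) (word_of (conj_act phi w)).
  exact: IHu.
have: b = letterV a.
  case/orP: (leq_total (size (rcons (word_of (f b.1)) (p b.1, b.2)))
     (size (rcons (word_of (f a.1)) (p a.1, ~~ a.2)))) => le_s.
    apply: disj; move: pb pw; rewrite !prefixE => /eqP Eb /eqP Ea.
    by rewrite -Ea take_takel // Eb.
  apply/esym/disj; move: pb pw; rewrite !prefixE => /eqP Eb /eqP Ea.
  by rewrite -Eb take_takel // Ea.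
by move=> bE; case/andP: (r) => /eqP.
Qed.

(** By surjectivity [x (p i)] is the image of some nonempty word with first letter [a]. Its
    one-letter word then has the prefix [f a.1] followed by a power of [x (p a.1)], which forces
    [f a.1 = 1] and [a.1 = i]. *)
Lemma conj_act_reduced phi p f :
  (forall i, conj_act phi (x i) = (f i * x (p i) * (f i)^-1)) ->
  (forall i b, reduced (rcons (word_of (f i)) (p i, b))) ->
  (forall i j b, i != j -> ~~ prefix (rcons (word_of (f i)) (p i, b)) (word_of (f j))) ->
  forall i, conj_act phi (x i) = x (p i).
Proof.
move=> phiE rf npf i.
have [[g _ gK] _] := autP (conj_aut_val phi).
have := gK (x (p i)); case: (g _) => [[|a u] r] E.
  by move/(congr1 (@word_of n)): E; rewrite (_ : FreeGroup _ = 1) ?aut_fun1 //; apply/val_inj.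
have := conj_act_prefix _ _ _ phiE rf npf _ _ r.
rewrite [conj_act _ _]E /=; case E1: (word_of (f a.1)) => [|c w]; last first.
  by case: (w) => [|? ?]; rewrite /= andbF.
rewrite /= => /andP[/eqP[/perm_inj aE _] _].
rewrite phiE (_ : f i = 1) ?mul1g ?invg1 ?mulg1 //.
by apply/val_inj; rewrite -aE.
Qed.

(** An induction principle, applied below with [alpha_T_product] as [S]. *)
Lemma conj_aut_generated (S : conj_aut n -> Prop) :
  (forall phi psi, S phi -> S psi -> S (phi * psi)) ->
  (forall phi, S phi -> S (phi^-1)) ->
  (forall phi p, (forall i, conj_act phi (x i) = x (p i)) -> S phi) ->
  (forall i j, i != j -> exists2 theta, S theta &
    forall k, conj_act theta (x k) =
      if k == j then (x i * x j * (x i)^-1) else x k) ->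
  forall phi, S phi.
Proof.
move=> SM SV Sperm Stheta.
(* Conjugation of [x j] by the inverse of [x i] is [theta^-1], because [theta] fixes [x i]. *)
have Stheta2 i j b : i != j -> exists2 theta, S theta &
    forall k, conj_act theta (x k) =
      if k == j then (letter_gen _ (i, b) * x j * (letter_gen _ (i, b))^-1) else x k.
  move=> ij; have [theta St tE] := Stheta i j ij.
  case: b; last by exists theta.
  have tK u : conj_act theta^-1 (conj_act theta u) = u.
    by rewrite -conj_actM mulgV.
  have ti : conj_act theta^-1 (x i) = x i by have := tK (x i); rewrite tE (negPf ij).
  exists (theta^-1); first exact: SV.
  move=> k; case: eqP => [->|/eqP kj].
    have := tK (x j); rewrite tE eqxx !conj_act_mul conj_actV ti => E.
    rewrite -[letter_gen _ _](letter_genV n (i, false)) invgK -{2}E.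
    by rewrite !mulgA mulVg mul1g mulgKV.
  by have := tK (x k); rewrite tE (negPf kj).
suff main N phi p f :
    (\sum_i size (word_of (f i)) < N)%N ->
    (forall i, conj_act phi (x i) = (f i * x (p i) * (f i)^-1)) -> S phi.
  move=> phi; have /asboolP[p [f phiE]] := conj_aut_valP phi.
  (* [conjugating] uses [f^-1 x f], the descent [f x f^-1]; hence the inverses. *)
  apply: (main _ phi p (fun i => (f i)^-1) (ltnSn _)) => i.
  by rewrite [conj_act _ _]phiE conjgE invgK mulgA.
elim: N phi p f => // N IHN phi p f; rewrite ltnS => leN phiE.
have step psi g j : (size (word_of g) < size (word_of (f j)))%N ->
    (forall i, conj_act psi (x i) =
      if i == j then (g * x (p j) * g^-1) else conj_act phi (x i)) -> S psi.
  move=> ltg psiE; apply: (IHN psi p (fun i => if i == j then g else f i)).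
    apply: leq_trans leN; rewrite (bigD1 j) //= [ltnRHS](bigD1 j) //= eqxx.
    rewrite -addSn leq_add // leq_sum // => i /negPf ->.
    exact: leqnn.
  by move=> i; rewrite psiE; case: eqP => [->|].
have [/existsP[j /existsP[b nr]]|rf] :=
    boolP [exists j, exists b, ~~ reduced (rcons (word_of (f j)) (p j, b))].
  have [v [c Ef]] : exists v c, word_of (f j) = rcons v (p j, c).
    move: nr (word_ofP (f j)); case: (lastP (word_of (f j))) => [|v [k c]] //.
    move=> nr rv; exists v, c; move: nr rv.
    case: v => [|d v]; rewrite /reduced /= ?rcons_path => nr rv.
      by move: nr; rewrite /= andbT negbK => /eqP[<- _].
    move: nr; rewrite rv /= last_rcons negbK.
    by move=> /eqP[<- _].
  have rv : reduced v.
    have := word_ofP (f j); rewrite Ef /reduced -cats1.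
    by case/cat_sorted2.
  have fE : f j = (FreeGroup rv * letter_gen _ (p j, c)).
    apply/val_inj; rewrite /= Ef cat_reduce_cat ?cats1 //.
    by rewrite -Ef; apply: word_ofP.
  apply: (step _ (FreeGroup rv) j); first by rewrite Ef size_rcons.
  move=> i; case: eqP => [->|//]; rewrite phiE fE invgM !mulgA.
  congr (_ * _); rewrite -!mulgA; congr (_ * _).
  case: (c); rewrite -?[letter_gen _ (_, true)](letter_genV n (_, false)).
    by rewrite invgK mulKg.
  by rewrite mulgA; apply: mulgK.
(* Second reduction: [f j = f i * y^-1 * z] with [y] the letter [(p i, ~~ b)]. Precomposing with
   [theta] multiplies [f j] on the left by [f i * y * (f i)^-1], which leaves the shorter
   [f i * z]. *)
have [/existsP[i /existsP[j /existsP[b /andP[ij /prefixP[z Ez]]]]]|npf] :=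
   boolP [exists i, exists j, exists b,
     (i != j) && prefix (rcons (word_of (f i)) (p i, b)) (word_of (f j))].
  have rz : reduced z.
    by have := word_ofP (f j); rewrite Ez /reduced; case/cat_sorted2.
  have fjE : f j = (f i * letter_gen _ (p i, b) * FreeGroup rz).
    apply/val_inj; rewrite -mulgA /= cat_rcons in Ez *.
    have := word_ofP (f j); rewrite Ez => r.
    by rewrite push_id ?cat_reduce_cat //; move: r; rewrite /reduced => /cat_sorted2[].
  have [theta St tE] := Stheta2 i j (~~ b) ij.
  suff Sp : S (theta * phi) by rewrite -[phi](mulKg theta); apply: SM => //; apply: SV.
  apply: (step _ (f i * FreeGroup rz) j).
    apply: leq_ltn_trans (size_cat_reduce _ _ _) _.
    by rewrite Ez size_cat size_rcons.
  move=> k; rewrite conj_actM (tE k); case: eqP => [_|//].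
  rewrite !conj_act_mul conj_actV (conj_act_letter _ _ _ phiE) phiE /=.
  set y := letter_gen _ (p i, ~~ b).
  have yE : letter_gen n (p i, b) = (y^-1).
    by rewrite letter_genV /letterV /= negbK.
  rewrite fjE yE !invgM !invgK !mulgA.
  by do 2!rewrite ?mulgKV ?mulgK.
apply: (Sperm phi p); apply: (conj_act_reduced _ _ _ phiE).
  move=> i b; apply: contraR rf => ?; apply/existsP; exists i.
  by apply/existsP; exists b.
move=> i j b ij; apply: contra npf => ?; apply/existsP; exists i.
by apply/existsP; exists j; apply/existsP; exists b; rewrite ij.
Qed.

End Generation.

(** * Every element of [C3] is a product of factors [A T^s] *)

Section Form.
Local Open Scope group_scope.

(** Exponents may be zero, so concatenating two lists of factors is again legitimate and no
    neighbouring factors have to be merged. *)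
Definition alpha_T_product (g : C3) : Prop :=
  exists2 l : seq (word * int), all (fun a => a.1 \in alpha_words) l &
    g = \prod_(a <- l) (word_val a.1 * expgz T a.2).

Lemma alpha_T_product1 : alpha_T_product 1.
Proof. by exists [::]; rewrite ?big_nil. Qed.

Lemma alpha_T_productM g h :
  alpha_T_product g -> alpha_T_product h -> alpha_T_product (g * h).
Proof.
move=> [l al ->] [m am ->]; exists (l ++ m); first by rewrite all_cat al.
by rewrite big_cat.
Qed.

Lemma word_val1 a : word_val [:: (a, 1%Z)] = generator_val a.
Proof. by rewrite /word_val big_cons big_nil mulg1. Qed.

Lemma alpha_T_product_alpha A : A \in alpha_words -> alpha_T_product (word_val A).
Proof.
move=> aA; exists [:: (A, 0%Z)]; first by rewrite /= aA.
by rewrite big_cons big_nil !mulg1.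
Qed.

Lemma alpha_T_product_alpha1 : alpha_T_product alpha1.
Proof.
rewrite -[alpha1]/(generator_val Alpha1) -word_val1.
exact: alpha_T_product_alpha.
Qed.

Lemma alpha_T_product_alpha2 : alpha_T_product alpha2.
Proof.
rewrite -[alpha2]/(generator_val Alpha2) -word_val1.
exact: alpha_T_product_alpha.
Qed.

Lemma alpha1V : alpha1^-1 = alpha1.
Proof. by case: C3_relations => _ [E _] _ _ _; apply: (mulgI alpha1); rewrite mulgV. Qed.

Lemma alpha2V : alpha2^-1 = alpha2.
Proof. by case: C3_relations => _ [_ E] _ _ _; apply: (mulgI alpha2); rewrite mulgV. Qed.

Lemma expgzN (G : groupType) (g : G) k : expgz g (- k)%R = (expgz g k)^-1.
Proof. by case: k => [[|m]|m]; rewrite //= ?invg1 ?invgK. Qed.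

(** Every factor starts with a nonempty alpha word, so [T^k] is written as
    [alpha1 T^0 alpha1 T^k]. *)
Lemma alpha_T_product_T k : alpha_T_product (expgz T k).
Proof.
exists [:: ([:: (Alpha1, 1%Z)], 0%Z); ([:: (Alpha1, 1%Z)], k)] => //.
rewrite !big_cons big_nil /= word_val1 !mulg1 mulgA.
by rewrite -{1}[generator_val _]alpha1V mulVg mul1g.
Qed.

Lemma alpha_T_product_alphaV A :
  A \in alpha_words -> alpha_T_product (word_val A)^-1.
Proof.
have p1 := alpha_T_product_alpha1; have p2 := alpha_T_product_alpha2.
have pM := alpha_T_productM.
rewrite !inE => /or4P[/eqP->|/eqP->|/eqP->|/orP[]/eqP->];
  rewrite /word_val !big_cons big_nil /= !expg1 !invgM invg1 ?alpha1V ?alpha2V mul1g;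
  by auto.
Qed.

Lemma alpha_T_productV g : alpha_T_product g -> alpha_T_product g^-1.
Proof.
move=> [l + ->]; elim: l => [|a l IHl] /= => [_|/andP[aA al]].
  by rewrite big_nil invg1; apply: alpha_T_product1.
rewrite big_cons !invgM -expgzN; apply: alpha_T_productM; first exact: IHl.
apply: alpha_T_productM; first exact: alpha_T_product_T.
exact: alpha_T_product_alphaV.
Qed.

Lemma sigma2E : sigma2 = T * alpha1 * alpha2.
Proof. by rewrite /T -{2}alpha1V -{2}alpha2V !mulgK. Qed.

Lemma sigma1E : sigma1 = alpha2 * alpha1 * sigma2 * alpha1 * alpha2.
Proof.
case: C3_relations => _ _ _ <- _.
by rewrite -{2}alpha1V -{2}alpha2V !mulgK.
Qed.

Lemma alpha_T_product_sigma2 : alpha_T_product sigma2.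
Proof.
rewrite sigma2E; apply: alpha_T_productM alpha_T_product_alpha2.
by apply: alpha_T_productM alpha_T_product_alpha1; apply: alpha_T_product_T 1%Z.
Qed.

Lemma alpha_T_product_sigma1 : alpha_T_product sigma1.
Proof.
have [p1 p2] := (alpha_T_product_alpha1, alpha_T_product_alpha2).
rewrite sigma1E; do 2![apply: alpha_T_productM => //].
by apply: alpha_T_productM alpha_T_product_sigma2; apply: alpha_T_productM.
Qed.

Lemma alpha_T_product_perm (phi : C3) (p : 'S_3) :
  (forall i, conj_act phi (free_gen i) = free_gen (p i)) -> alpha_T_product phi.
Proof.
have p0 := alpha_T_product1.
have p1 := alpha_T_product_alpha1; have p2 := alpha_T_product_alpha2.
have pM := alpha_T_productM.
suff main : exists2 psi, alpha_T_product psi &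
    forall i, conj_act psi (free_gen i) = free_gen (p i).
  by move=> phiE; have [psi ? psiE] := main; rewrite (_ : phi = psi) //;
     apply: conj_aut_eq => i; rewrite phiE psiE.
have p12 : p i1 != p i2 by rewrite (inj_eq perm_inj).
have p13 : p i1 != p i3 by rewrite (inj_eq perm_inj).
have p23 : p i2 != p i3 by rewrite (inj_eq perm_inj).
suff main a b c : a != b -> a != c -> b != c -> exists2 psi, alpha_T_product psi &
    forall i, conj_act psi (free_gen i) = free_gen (nth i1 [:: a; b; c] i).
  have [psi ? psiE] := main _ _ _ p12 p13 p23; exists psi => // i.
  by rewrite psiE; elim/ord3P: i.
(* The six triples of distinct images appear in lexicographic order, and so do the witnesses. *)
elim/ord3P: a; elim/ord3P: b; elim/ord3P: c => //= _ _ _;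
 [exists 1|exists alpha2|exists alpha1|exists (alpha2 * alpha1)|exists (alpha1 * alpha2)
 |exists (alpha1 * (alpha2 * alpha1))];
 by [auto|apply: ord3P; apply/val_inj; vm_compute].
Qed.

Lemma alpha_T_product_all (g : C3) : alpha_T_product g.
Proof.
have p1 := alpha_T_product_alpha1; have p2 := alpha_T_product_alpha2.
have p3 := alpha_T_product_sigma1; have p4 := alpha_T_product_sigma2.
have pM := alpha_T_productM.
move: g; apply: conj_aut_generated => [|||i j]; first exact: pM.
- exact: alpha_T_productV.
- exact: alpha_T_product_perm.
(* The pairs [(i, j)] appear in lexicographic order. For adjacent indices an alpha undoes the swap
   contained in a sigma; [(1, 3)] and [(3, 1)] are obtained from [(1, 2)] and [(2, 1)] by
   conjugation with [alpha2]. *)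
elim/ord3P: i; elim/ord3P: j => //= _;
 [exists (alpha1 * sigma1)|exists (alpha2 * (alpha1 * (sigma1 * alpha2)))
 |exists (sigma1 * alpha1)|exists (alpha2 * sigma2)
 |exists (alpha2 * (sigma1 * (alpha1 * alpha2)))|exists (sigma2 * alpha2)];
 by [auto 6|apply: ord3P; apply/val_inj; vm_compute].
Qed.

End Form.

(** * The determinant as a homomorphism to the scalars *)

Section Determinant.
Set Implicit Arguments.
Unset Strict Implicit.
Variables (K : fieldType) (n : nat) (G : groupType) (rho : G -> 'M[K]_n).
Hypothesis rho_hom : GL_hom rho.

(** [rho 1] is idempotent and invertible. *)
Lemma GL_hom1 : rho 1%g = 1%:M.
Proof.
have [U M] := rho_hom; have := M 1%g 1%g; rewrite mulg1 => E.
by rewrite -[LHS](mulmxK (U 1%g)) -E mulmxV.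
Qed.

Definition det_hom (g : G) : K := \det (rho g).

Lemma det_homM g h : det_hom (g * h)%g = det_hom g * det_hom h.
Proof. by have [_ M] := rho_hom; rewrite /det_hom M det_mulmx. Qed.

Lemma det_hom1 : det_hom 1%g = 1.
Proof. by rewrite /det_hom GL_hom1 det1. Qed.

Lemma det_homV g : det_hom g^-1%g = (det_hom g)^-1.
Proof.
have E : det_hom g * det_hom g^-1%g = 1 by rewrite -det_homM mulgV det_hom1.
have nz : det_hom g != 0 by apply: contra_eq_neq E => ->; rewrite mul0r eq_sym oner_neq0.
by apply: (mulfI nz); rewrite E mulfV.
Qed.

Lemma det_hom_expgz g k : det_hom (expgz g k) = det_hom g ^ k.
Proof.
have X m : det_hom (g ^+ m)%g = det_hom g ^+ m.
  by elim: m => [|m IHm]; rewrite ?det_hom1 // expgS exprS det_homM IHm.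
by case: k => m; rewrite /= ?det_homV X.
Qed.

Lemma det_hom_prod (I : Type) (r : seq I) (F : I -> G) :
  det_hom (\prod_(i <- r) F i)%g = \prod_(i <- r) det_hom (F i).
Proof. exact: (big_morph _ det_homM det_hom1). Qed.

End Determinant.

Lemma det_mx_of_rows (K : comNzRingType) (a b c d e f g h i : K) :
  \det (mx_of_rows [:: [:: a; b; c]; [:: d; e; f]; [:: g; h; i]]) =
  a * (e * i - f * h) - b * (d * i - f * g) + c * (d * h - e * g).
Proof.
rewrite (expand_det_row _ ord0) !big_ord_recl big_ord0 addr0 /cofactor /=.
rewrite !(expand_det_row _ ord0) !big_ord_recl !big_ord0 /cofactor !det_mx11 !mxE /=.
ring.
Qed.

Theorem theorem7 (R : realType) (q : R[i]) (rho : C3 -> 'M[R[i]]_3)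
    (q_neq0 : q != 0)
    (q_generic : forall k : int, k != 0 -> q ^ (6 * k) != 1)
    (rhoP : is_rho q rho)
    (g : C3) (g_ker : rho g = 1%:M) :
  exists (r : nat) (A : 'I_r -> word) (s : 'I_r -> int),
    [/\ (1 <= r)%N,
        \sum_(i < r) s i = 0,
        ~~ odd (\sum_(i < r) word_length (A i))%N,
        forall i, A i \in alpha_words &
        g = (\prod_(i < r) (word_val (A i) * expgz T (s i)))%g \/
        g = (\prod_(i < r) (expgz T (s i) * word_val (A i)))%g].
Proof.
have [rho_hom _ rs2 ra1 ra2] := rhoP.
have d1 : det_hom rho alpha1 = -1 by rewrite /det_hom ra1 det_mx_of_rows; ring.
have d2 : det_hom rho alpha2 = -1 by rewrite /det_hom ra2 det_mx_of_rows; ring.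
have dT : det_hom rho T = - q ^+ 3.
  rewrite /T !(det_homM rho_hom) d1 d2 /det_hom rs2 det_mx_of_rows; ring.
have dA A : A \in alpha_words -> det_hom rho (word_val A) = (-1) ^+ word_length A.
  rewrite !inE => /or4P[/eqP->|/eqP->|/eqP->|/orP[]/eqP->];
  rewrite /word_val /word_length !big_cons !big_nil /= !expg1 ?mulg1
    ?(det_homM rho_hom) ?d1 ?d2; ring.
have [l al gl] : exists2 l : seq (word * int), all (fun a => a.1 \in alpha_words) l &
    g = (\prod_(a <- l) (word_val a.1 * expgz T a.2))%g by apply: alpha_T_product_all.
(* Padding by [1 = alpha1 T^0 alpha1 T^0] makes the product nonempty. *)
pose a0 : word * int := ([:: (Alpha1, 1%Z)], 0).
have {gl} gl : g = (\prod_(a <- [:: a0, a0 & l]) (word_val a.1 * expgz T a.2))%g.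
  rewrite !big_cons -gl /= word_val1 !mulg1 mulgA.
  by rewrite -{1}[generator_val _]alpha1V mulVg mul1g.
have {al} : all (fun a => a.1 \in alpha_words) [:: a0, a0 & l] by [].
move: [:: a0, a0 & l] (isT : (0 < size [:: a0, a0 & l])%N) gl => {}l l_gt0 gl al.
(* The default [a0] itself carries an admissible word, so the bound on [i] can be omitted. *)
have alP i : (nth a0 l i).1 \in alpha_words.
  have [lt|ge] := ltnP i (size l); first exact: (all_nthP _ al).
  by rewrite nth_default.
have det_g : (-1) ^+ (\sum_(a <- l) word_length a.1)%N *
    (- q ^+ 3) ^ (\sum_(a <- l) a.2) = 1 :> R[i].
  transitivity (det_hom rho g); last by rewrite /det_hom g_ker det1.
  rewrite gl (det_hom_prod rho_hom) {gl l_gt0 alP}; apply/esym.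
  elim: l al => [|a l IHl] /=; first by rewrite !big_nil mulr1.
  case/andP=> aA al; rewrite !big_cons IHl // det_homM // det_hom_expgz // dT dA //.
  rewrite exprD expfzDr; last by rewrite oppr_eq0 expf_neq0.
  by rewrite mulrACA.
have s0 : \sum_(a <- l) a.2 = 0 :> int.
  apply/eqP/negPn/negP => /q_generic/eqP; apply.
  (* The square of [- q ^+ 3] is [q ^+ 6], the source of the 6 in [q_generic]; squaring [det_g] also
     removes the sign of the alpha words. *)
  have -> : q ^ (6 * \sum_(a <- l) a.2) = ((- q ^+ 3) ^ (\sum_(a <- l) a.2)) ^+ 2.
    rewrite -exprz_exp (_ : q ^ 6 = (- q ^+ 3) ^ 2); last by rewrite -!exprnP; ring.
    by rewrite exprz_exp mulrC -exprz_exp.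
  by have := congr1 (fun x => x ^+ 2) det_g; rewrite /= exprMn sqrr_sign mul1r expr1n.
have even_l : ~~ odd (\sum_(a <- l) word_length a.1)%N.
  move: det_g; rewrite s0 expr0z mulr1 -signr_odd; case: odd => //=.
  (* An odd length would give [-1 = 1], that is [2 = 0], impossible in characteristic zero. *)
  by move/esym/eqP; rewrite -addr_eq0 (Num.Theory.pnatr_eq0 _ 2).
move: s0 even_l gl; rewrite !(big_nth a0) !big_mkord => s0 even_l gl.
exists (size l), (fun i => (nth a0 l i).1), (fun i => (nth a0 l i).2).
(* The product built here always has form (a). *)
by split=> //; left.
Qed.
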